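(* Let $A, B, X$ be $n\times n$ complex matrices such that the $2n\times 2n$ block matrix $M=\begin{bmatrix} A & X\\ X^* & B\end{bmatrix}$ is positive semi-definite. If $\operatorname{Im}(X)=rI_n$ or $\operatorname{Re}(X)=rI_n$ for some $r$, then $\|M\|\le \|A+B\|$ for all symmetric norms.
   Context: For a square complex matrix $X$, $\operatorname{Im}(X)=\frac{X-X^*}{2i}$ and $\operatorname{Re}(X)=\frac{X+X^*}{2}$ (both are Hermitian matrices, so the scalar $r$ is necessarily real). $I_n$ is the $n\times n$ identity matrix. A symmetric norm is a unitarily invariant norm on square complex matrices, i.e. $\|UHV\|=\|H\|$ for all unitary matrices $U,V$. A symmetric norm on the space of $m\times m$ complex matrices induces a symmetric norm on $n\times n$ matrices ($n<m$) by $\|H\|=\|H\oplus 0\|$, where $H\oplus 0$ is the $m\times m$ matrix having $H$ as a diagonal block and zeros elsewhere. With this convention, norms are regarded as defined on square matrices of all sizes; in particular, $\|A+B\|$ means $\|(A+B)\oplus 0_n\|$ in the given norm on $2n\times 2n$ matrices. *)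

(* Defs.v *)
From mathcomp Require Export all_boot all_order all_algebra.
From mathcomp Require Export reals.
From mathcomp Require Export complex.

Set Implicit Arguments.
Unset Strict Implicit.
Unset Printing Implicit Defensive.

Import Order.TTheory GRing.Theory Num.Theory.
Local Open Scope ring_scope.
Local Open Scope sesquilinear_scope.

Definition Re_mx (R : realType) (n : nat) (X : 'M[R[i]]_n) : 'M[R[i]]_n :=
  2^-1 *: (X + X ^t*).

Definition Im_mx (R : realType) (n : nat) (X : 'M[R[i]]_n) : 'M[R[i]]_n :=
  (2 * (0 +i* 1)%C)^-1 *: (X - X ^t*).

(* In R[i], [0 <= z] says that z is real and nonnegative. *)
Definition psdmx (R : realType) (n : nat) (M : 'M[R[i]]_n) : Prop :=
  M \is hermsymmx /\
  forall x : 'cV[R[i]]_n, 0 <= (x ^t* *m M *m x) 0 0.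

(* A predicate rather than a [normedZmodType], since many norms on the same
   carrier are considered.  [Normc.normc] is the R-valued modulus on R[i]. *)
Record is_norm (R : realType) (m : nat) (N : 'M[R[i]]_m -> R) : Prop := {
  norm_ge0 : forall H, 0 <= N H;
  norm_definite : forall H, N H = 0 -> H = 0;
  norm_scale : forall (a : R[i]) H, N (a *: H) = Normc.normc a * N H;
  norm_triangle : forall H K, N (H + K) <= N H + N K
}.

Record symmetric_norm (R : realType) (m : nat) (N : 'M[R[i]]_m -> R) : Prop := {
  symmetric_norm_is_norm : is_norm N;
  symmetric_norm_unitary : forall U V H : 'M[R[i]]_m,
    U \is unitarymx -> V \is unitarymx -> N (U *m H *m V) = N H
}.

(* The norm induced on n x n matrices by a norm on larger matrices,
   H |-> N (H (+) 0). *)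
Definition induced_norm (R : realType) (n k : nat)
    (N : 'M[R[i]]_(n + k) -> R) (H : 'M[R[i]]_n) : R :=
  N (block_mx H 0 0 0).

(* Main.v *)
(** For a unit scalar w with w X + (w X)^* = 2r I, the unitary with block rows
    (I, I) and (w, -w), up to the factor 1/sqrt 2, turns M into a matrix whose
    diagonal blocks are (A + B)/2 + r and (A + B)/2 - r.  These are diagonalized
    in one common basis, with their entries in the same decreasing order, so
    Ky Fan's inequality for M, seen as a sum of two positive matrices with these
    spectra, bounds the sum of the l largest eigenvalues of M by that of A + B.
    The traces agree, hence the spectrum of M is majorized by that of
    (A + B) (+) 0, and a T-transform argument concludes for every symmetric
    norm. *)
From mathcomp Require Import perm ring lra.
Require Import Defs.

Set Implicit Arguments.
Unset Strict Implicit.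
Unset Printing Implicit Defensive.

Import Order.TTheory GRing.Theory Num.Theory.
Local Open Scope ring_scope.
Local Open Scope sesquilinear_scope.

(** * Prefix sums, majorization and T-transforms *)

(** For [l < n], let [c] be the entry just after the prefix. Each [(g j - [j < l]) * (p j - c)] is
    nonpositive, and what remains is [c] times the nonpositive [\sum_j g j - l]. *)
Lemma le_sum_prefix (R : numFieldType) (n l : nat) (p g : 'I_n -> R) :
  (forall i j : 'I_n, (i <= j)%N -> p j <= p i) -> (forall j, 0 <= p j) ->
  (forall j, 0 <= g j <= 1) -> \sum_j g j <= l%:R ->
  \sum_j g j * p j <= \sum_(j < n | (j < l)%N) p j.
Proof.
move=> p_dec p_ge0 g01 g_le.
have [n_le_l|l_lt_n] := leqP n l.
  rewrite [leRHS](eq_bigl predT) => [|j]; last by rewrite (leq_trans (ltn_ord j)).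
  apply: ler_sum => j _; have /andP[_ gj1] := g01 j.
  by rewrite ler_piMl.
pose c := p (Ordinal l_lt_n).
have sum1 : \sum_(j < n) (j < l)%N%:R = l%:R :> R.
  rewrite -[l in RHS]card_ord -sumr_const (big_ord_widen n (fun=> 1)) 1?ltnW //.
  by rewrite [RHS]big_mkcond; apply: eq_bigr => j _; case: ltnP.
have term j : g j * p j <= (if (j < l)%N then p j else 0) + (g j - (j < l)%N%:R) * c.
  have /andP[gj0 gj1] := g01 j.
  rewrite -subr_ge0; case: ltnP => jl /=.
    rewrite [X in 0 <= X](_ : _ = (1 - g j) * (p j - c)); last by ring.
    by rewrite mulr_ge0 ?subr_ge0 // p_dec // ltnW.
  rewrite [X in 0 <= X](_ : _ = g j * (c - p j)); last by ring.
  by rewrite mulr_ge0 ?subr_ge0 // p_dec.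
apply: le_trans; first by apply: ler_sum => j _; apply: term.
rewrite big_split /= -big_mkcond /= gerDl -mulr_suml sumrB sum1.
by apply: mulr_le0_ge0; rewrite ?subr_le0 ?p_ge0.
Qed.

(** Ky Fan's bound for one positive summand, meant for [a i j = x 0 i * |W i j|^2]. The first [l]
    rows fill a fraction [g j] of column [j]; by the row condition these fractions add up to at most
    [l]. *)
Lemma le_sum_prefix_columns (R : numFieldType) (m n l : nat)
    (a : 'I_m -> 'I_n -> R) (p : 'I_n -> R) :
  (forall i j, 0 <= a i j) -> (forall j, p j = \sum_i a i j) ->
  (forall i j : 'I_n, (i <= j)%N -> p j <= p i) ->
  (forall i, \sum_j a i j / p j <= 1) ->
  \sum_(i < m | (i < l)%N) \sum_j a i j <= \sum_(j < n | (j < l)%N) p j.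
Proof.
move=> a_ge0 pE p_dec row_le.
have p_ge0 j : 0 <= p j by rewrite pE sumr_ge0.
have part_ge0 j : 0 <= \sum_(i < m | (i < l)%N) a i j by apply: sumr_ge0.
have part_le j : \sum_(i < m | (i < l)%N) a i j <= p j.
  by rewrite pE [leRHS](bigID (fun i : 'I_m => (i < l)%N)) /= lerDl sumr_ge0.
pose g j := (\sum_(i < m | (i < l)%N) a i j) / p j.
(* If [p j = 0] the quotient is 0 by convention, but the partial column sum, squeezed between 0 and
   [p j], vanishes too. *)
have gpE j : g j * p j = \sum_(i < m | (i < l)%N) a i j.
  have [pj0|pj0] := eqVneq (p j) 0; last by rewrite divfK.
  by apply/le_anti; rewrite pj0 mulr0 part_ge0 -[X in _ <= X]pj0 part_le.
rewrite exchange_big /= -(eq_bigr _ (fun j _ => gpE j)).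
apply: le_sum_prefix => // [j|].
  rewrite /g divr_ge0 //=; have [pj0|pj0] := eqVneq (p j) 0.
    by rewrite pj0 invr0 mulr0 ler01.
  by rewrite ler_pdivrMr ?mul1r // lt_def pj0 p_ge0.
rewrite (eq_bigr _ (fun j _ => mulr_suml _ _ _ _)) exchange_big /=.
apply: le_trans (_ : \sum_(i < m | (i < l)%N) 1 <= _).
  by apply: ler_sum => i _; apply: row_le.
have [lm|/ltnW ml] := leqP l m.
  by rewrite -(big_ord_widen _ (fun=> 1) lm) sumr_const card_ord.
by rewrite sumr_const ler_nat (leq_trans (max_card _)) ?card_ord.
Qed.

(* Induction on the number of coordinates where [x] and [y] differ: a T-transform
   at positions j < k with x j < y j and y k < x k makes one more of them agree.
   Taking k minimal preserves the prefix inequalities, so [y] need not be sorted. *)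
Lemma majorization_le (R : realFieldType) (m : nat) (f : 'rV[R]_m -> R) :
  (forall (t : R) (x y : 'rV_m), 0 <= t <= 1 ->
     f ((1 - t) *: x + t *: y) <= (1 - t) * f x + t * f y) ->
  (forall i j x, f (xcol i j x) = f x) ->
  forall x y : 'rV[R]_m,
    (forall i j : 'I_m, (i <= j)%N -> x 0 j <= x 0 i) ->
    (forall l : nat,
       \sum_(i < m | (i < l)%N) x 0 i <= \sum_(i < m | (i < l)%N) y 0 i) ->
    \sum_i x 0 i = \sum_i y 0 i -> f x <= f y.
Proof.
move=> f_conv f_sym x y x_dec.
have [d] := ubnP #|[set i | x 0 i != y 0 i]|.
elim: d y => // d IHd y; rewrite ltnS => card_le pre tot.
have [[k0 k0P]|no_k] := altP (@existsP _ (fun i => y 0 i < x 0 i)); last first.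
  have xy i : x 0 i <= y 0 i.
    by rewrite leNgt; apply: contra no_k => h; apply/existsP; exists i.
  suff -> : x = y by [].
  apply/rowP => i; apply/eqP; rewrite eq_sym -subr_eq0.
  have /eqP : \sum_i (y 0 i - x 0 i) = 0 by rewrite sumrB tot subrr.
  rewrite psumr_eq0 => [/allP/(_ i)|j _]; last by rewrite subr_ge0.
  by rewrite mem_index_enum => /(_ isT).
case: (@arg_minnP _ k0 (fun i => y 0 i < x 0 i) val k0P) => k yxk kmin.
have below_k (i : 'I_m) : (i < k)%N -> x 0 i <= y 0 i.
  by move=> ik; rewrite leNgt; apply/negP => /kmin; rewrite leqNgt ik.
(* Without such a [j], no entry of [y] before [k] would exceed that of [x], and the deficit at [k]
   would break the prefix inequality of length [k.+1]. *)
have [j jk xyj] : exists2 j : 'I_m, (j < k)%N & x 0 j < y 0 j.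
  have [/existsP[j /andP[]]|no_j] :=
    boolP [exists j : 'I_m, (j < k)%N && (x 0 j < y 0 j)].
    by exists j.
  have := pre k.+1; rewrite leNgt => /negP[].
  rewrite (bigD1 k) //= [ltRHS](bigD1 k) //=; apply: ltr_leD => //.
  apply: ler_sum => i /andP[ik nik].
  rewrite leNgt; apply: contra no_j => h; apply/existsP; exists i.
  by rewrite h andbT ltn_neqAle nik -ltnS.
have xkj : x 0 k <= x 0 j by apply: x_dec; apply: ltnW.
(* The largest transfer from [j] to [k] that overshoots neither target; [t] below is the parameter
   whose T-transform moves exactly this amount. *)
pose e := Num.min (y 0 j - x 0 j) (x 0 k - y 0 k).
have e_gt0 : 0 < e by rewrite lt_min !subr_gt0 xyj yxk.
have e_le1 : e <= y 0 j - x 0 j by rewrite ge_min lexx.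
have e_le2 : e <= x 0 k - y 0 k by rewrite ge_min lexx orbT.
have D_gt0 : 0 < y 0 j - y 0 k by lra.
pose t := e / (y 0 j - y 0 k).
have tD : t * (y 0 j - y 0 k) = e by rewrite divfK ?gt_eqF.
have t01 : 0 <= t <= 1.
  by rewrite divr_ge0 ?(ltW e_gt0) ?(ltW D_gt0) //= ler_pdivrMr // mul1r; lra.
pose y' := (1 - t) *: y + t *: xcol j k y.
have njk : k != j by rewrite eq_sym neq_ltn jk.
have y'E i : y' 0 i = y 0 i - e *+ (i == j) + e *+ (i == k).
  rewrite !mxE; case: tpermP => [->|->|/eqP/negPf-> /eqP/negPf->].
  - by rewrite eqxx (eq_sym j k) (negPf njk) mulr1n mulr0n; lra.
  - by rewrite eqxx (negPf njk) mulr1n mulr0n; lra.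
  - by rewrite mulr0n; lra.
have y'j : y' 0 j = y 0 j - e.
  by rewrite y'E eqxx (eq_sym j k) (negPf njk) mulr1n mulr0n addr0.
have y'k : y' 0 k = y 0 k + e.
  by rewrite y'E eqxx (negPf njk) mulr1n mulr0n subr0.
have sumE (P : pred 'I_m) : \sum_(i | P i) y' 0 i =
    \sum_(i | P i) y 0 i - e *+ P j + e *+ P k.
  have delta i : \sum_(i' | P i') e *+ (i' == i) = e *+ P i.
    have [Pi|nPi] := boolP (P i).
      rewrite (bigD1 i) //= eqxx big1 ?addr0 // => i' /andP[_ /negPf->].
      by rewrite mulr0n.
    by rewrite big1 // => i' Pi'; case: eqP Pi' nPi => // -> ->.
  by rewrite (eq_bigr _ (fun i _ => y'E i)) big_split sumrB /= !delta.
have fy' : f y' <= f y.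
  apply: le_trans (f_conv _ _ _ t01) _.
  by rewrite f_sym -mulrDl subrK mul1r.
apply: le_trans fy'; apply: IHd => [|l|].
- apply: leq_trans card_le; apply: proper_card; apply/properP; split.
    apply/subsetP => i; rewrite !inE y'E.
    have [->|nij] := eqVneq i j; first by rewrite (lt_eqF xyj).
    have [->|nik] := eqVneq i k; first by rewrite (gt_eqF yxk).
    by rewrite !mulr0n subr0 addr0.
  case: (leP (y 0 j - x 0 j) (x 0 k - y 0 k)) => h.
    exists j; rewrite !inE ?(lt_eqF xyj) // y'j /e (min_idPl h) negbK.
    by apply/eqP; lra.
  exists k; rewrite !inE ?(gt_eqF yxk) // y'k /e (min_idPr (ltW h)) negbK.
  by apply/eqP; lra.
(* The prefix sum changes only for [j < l <= k]. There [y' 0 j] is still at least [x 0 j], and the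
   other entries before [k] dominate those of [x] by minimality of [k]. *)
- rewrite sumE; have [kl|lk] := ltnP k l.
    by rewrite (ltn_trans jk kl) subrK.
  have [jl|lj] := ltnP j l; last by rewrite !mulr0n subr0 addr0.
  rewrite mulr1n mulr0n addr0 (bigD1 j) //= [X in X - _](bigD1 j) //=.
  suff : \sum_(i < m | (i < l)%N && (i != j)) x 0 i <=
     \sum_(i < m | (i < l)%N && (i != j)) y 0 i by lra.
  by apply: ler_sum => i /andP[il _]; rewrite below_k // (leq_trans il).
- by rewrite sumE subrK.
Qed.

Lemma exists_perm_nonincreasing (R : realDomainType) (n : nat) (f : 'I_n -> R) :
  exists s : 'S_n, forall i j : 'I_n, (i <= j)%N -> f (s j) <= f (s i).
Proof.
pose t := [tuple f i | i < n].
have tot : total (>=%R : rel R) by move=> a b; apply: le_total.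
have /tuple_permP[s sE] : perm_eq (sort_tuple >=%R t) t by rewrite perm_sort.
exists s => i j ij.
have srt : sorted >=%R (sort >=%R t) by apply: sort_sorted.
have nthE (k : 'I_n) : nth 0 (sort >=%R t) k = f (s k).
  have -> : sort >=%R t = [tuple tnth t (s i) | i < n] by exact: sE.
  by rewrite -tnth_nth !tnth_mktuple.
rewrite -!nthE.
have ge_tr : transitive (>=%R : rel R) by move=> a b c ba cb; apply: le_trans cb ba.
have ge_refl : reflexive (>=%R : rel R) by move=> a; apply: lexx.
by apply: (sorted_leq_nth ge_tr ge_refl 0 srt); rewrite // inE size_sort size_tuple.
Qed.

(** * Compressions of a diagonal matrix and Ky Fan's inequality *)

Section Unitary.

Variable C : numClosedFieldType.

Lemma perm_mx_unitary n (s : 'S_n) : perm_mx s \is (@unitarymx C n n).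
Proof.
by apply/unitarymxP; rewrite tr_perm_mx map_perm_mx -perm_mxM mulgV perm_mx1.
Qed.

Lemma diag_mx_col_perm n (s : 'S_n) (x : 'rV[C]_n) :
  diag_mx (col_perm s x) = perm_mx s *m diag_mx x *m (perm_mx s)^t*.
Proof.
rewrite tr_perm_mx map_perm_mx -row_permE -col_permE.
by apply/matrixP => i j; rewrite !mxE (inj_eq perm_inj).
Qed.

Lemma mxtC_mul m n p (A : 'M[C]_(m, n)) (B : 'M[C]_(n, p)) :
  (A *m B)^t* = B^t* *m A^t*.
Proof. by rewrite trmx_mul map_mxM. Qed.

Lemma mxtC_scale m n (a : C) (A : 'M[C]_(m, n)) : (a *: A)^t* = a^* *: A^t*.
Proof. by rewrite linearZ map_mxZ. Qed.

Lemma unitarymx_tmul n (U : 'M[C]_n) : U \is unitarymx -> U^t* *m U = 1%:M.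
Proof. by move=> /unitarymxP/mulmx1C. Qed.

Lemma diag_conj_entry m n (W : 'M[C]_(m, n)) (x : 'rV[C]_m) j k :
  (W^t* *m diag_mx x *m W) j k = \sum_i x 0 i * (W i j)^* * W i k.
Proof.
rewrite mxE; apply: eq_bigr => i _; congr (_ * _).
by rewrite mul_mx_diag !mxE mulrC.
Qed.

Lemma diag_conj_diag m n (W : 'M[C]_(m, n)) (x : 'rV[C]_m) (p : 'rV[C]_n) :
  W^t* *m diag_mx x *m W = diag_mx p ->
  forall j, p 0 j = \sum_i x 0 i * `|W i j| ^+ 2.
Proof.
move=> WxW j; have := congr1 (fun D : 'M_n => D j j) WxW.
rewrite diag_conj_entry !mxE eqxx mulr1n => <-.
by apply: eq_bigr => k _; rewrite -mulrA [_^* * _]mulrC -normCK.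
Qed.

(* Testing the form against the vector of entries conj (W i j) / p j. *)
Lemma weighted_bessel m n (W : 'M[C]_(m, n)) (x : 'rV[C]_m) (p : 'rV[C]_n) :
  (forall i, 0 <= x 0 i) -> W^t* *m diag_mx x *m W = diag_mx p ->
  forall i, \sum_j x 0 i * `|W i j| ^+ 2 / p 0 j <= 1.
Proof.
move=> x_ge0 WxW i; have pE := diag_conj_diag WxW.
have p_ge0 j : 0 <= p 0 j.
  by rewrite pE sumr_ge0 // => k _; rewrite mulr_ge0 // exprn_ge0.
pose b := \sum_j `|W i j| ^+ 2 / p 0 j.
have b_ge0 : 0 <= b.
  by apply: sumr_ge0 => j _; rewrite divr_ge0 // exprn_ge0.
pose v : 'cV[C]_n := \col_j ((W i j)^* / p 0 j).
have Wv : (W *m v) i 0 = b.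
  by rewrite mxE; apply: eq_bigr => j _; rewrite mxE mulrA -normCK.
have form1 : ((W *m v)^t* *m diag_mx x *m (W *m v)) 0 0 = b.
  have -> : (W *m v)^t* *m diag_mx x *m (W *m v) =
      v^t* *m ((W^t* *m diag_mx x *m W) *m v) by rewrite mxtC_mul !mulmxA.
  rewrite WxW mul_diag_mx.
  rewrite mxE; apply: eq_bigr => j _; rewrite !mxE.
  have [pj0|pj0] := eqVneq (p 0 j) 0.
    by rewrite pj0 invr0 !mulr0.
  rewrite (mulrC (p 0 j)) divfK // rmorphM /= conjCK fmorphV /=.
  by rewrite (CrealP (ger0_real (p_ge0 j))) mulrAC -normCK.
(* The left side is the term of index [i] in the form at [W *m v], all of whose terms are
   nonnegative. *)
have : x 0 i * b ^+ 2 <= b.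
  rewrite -{2}form1 diag_conj_entry (bigD1 i) //= Wv.
  rewrite (CrealP (ger0_real b_ge0)) -mulrA -expr2 lerDl.
  apply: sumr_ge0 => k _.
  by rewrite -mulrA [_^* * _]mulrC -normCK mulr_ge0 // exprn_ge0.
rewrite (eq_bigr (fun j => x 0 i * (`|W i j| ^+ 2 / p 0 j))); last first.
  by move=> j _; rewrite -mulrA.
rewrite -mulr_sumr -/b.
have [->|b0] := eqVneq b 0; first by rewrite mulr0 ler01.
by rewrite expr2 mulrA -[X in _ <= X -> _]mul1r ler_pM2r // lt_def b0.
Qed.

(** The rows of [[W1 W2]] have unit length, so each [x 0 i] splits into two row sums, bounded
    separately through [p] and [q]. As both are sorted along the same index, their prefixes add up
    to a prefix of the sum. *)
Lemma diag_blocks_prefix m n (W1 W2 : 'M[C]_(m, n)) (x : 'rV[C]_m)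
    (p q : 'rV[C]_n) :
  W1 *m W1^t* + W2 *m W2^t* = 1%:M ->
  (forall i, 0 <= x 0 i) ->
  W1^t* *m diag_mx x *m W1 = diag_mx p ->
  W2^t* *m diag_mx x *m W2 = diag_mx q ->
  (forall i j : 'I_n, (i <= j)%N -> p 0 j <= p 0 i) ->
  (forall i j : 'I_n, (i <= j)%N -> q 0 j <= q 0 i) ->
  (forall l : nat, \sum_(i < m | (i < l)%N) x 0 i <=
     \sum_(j < n | (j < l)%N) (p 0 j + q 0 j)) /\
  \sum_i x 0 i = \sum_j (p 0 j + q 0 j).
Proof.
move=> W1W2 x_ge0 Wp Wq p_dec q_dec.
pose a (W : 'M[C]_(m, n)) i j := x 0 i * `|W i j| ^+ 2.
have a_ge0 W i j : 0 <= a W i j by rewrite mulr_ge0 // exprn_ge0.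
have xE i : x 0 i = \sum_j a W1 i j + \sum_j a W2 i j.
  rewrite -!mulr_sumr -mulrDr -[LHS]mulr1; congr (_ * _).
  have := congr1 (fun D : 'M_m => D i i) W1W2.
  rewrite !mxE eqxx mulr1n => <-.
  by congr (_ + _); apply: eq_bigr => j _; rewrite !mxE normCK.
split=> [l|].
  rewrite (eq_bigr _ (fun i _ => xE i)) !big_split lerD //=.
    apply: le_sum_prefix_columns (a_ge0 W1) (diag_conj_diag Wp) p_dec _.
    exact: weighted_bessel Wp.
  apply: le_sum_prefix_columns (a_ge0 W2) (diag_conj_diag Wq) q_dec _.
  exact: weighted_bessel Wq.
rewrite (eq_bigr _ (fun i _ => xE i)) !big_split /=; congr (_ + _).
  by rewrite exchange_big; apply: eq_bigr => j _; rewrite (diag_conj_diag Wp).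
by rewrite exchange_big; apply: eq_bigr => j _; rewrite (diag_conj_diag Wq).
Qed.

End Unitary.

(** * Sorted spectra and symmetric norms *)

Section Norm.

Variable R : realType.
Local Notation C := R[i].
Local Notation toC := (real_complex R).

Lemma hermsymmx_spectral n (H : 'M[C]_n) : H \is hermsymmx ->
  exists (U : 'M[C]_n) (x : 'rV[R]_n),
    [/\ U \is unitarymx, H = U^t* *m diag_mx (map_mx toC x) *m U
       & forall i j : 'I_n, (i <= j)%N -> x 0 j <= x 0 i].
Proof.
move=> Hherm; pose d := spectral_diag H; pose P := spectralmx H.
have Pu : P \is unitarymx := spectral_unitarymx H.
have HE : H = P^t* *m diag_mx d *m P.
  have /orthomx_spectralP := hermitian_normalmx Hherm.
  by rewrite invmx_unitary.
(* The order of [R[i]] is partial, so the eigenvalues, which are real, are sorted by their real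
   parts. *)
have [s sP] := exists_perm_nonincreasing (fun i => complex.Re (d 0 i)).
exists (perm_mx s *m P), (\row_i complex.Re (d 0 (s i))); split.
- by rewrite mul_unitarymx ?perm_mx_unitary.
- have -> : map_mx toC (\row_i complex.Re (d 0 (s i))) = col_perm s d.
    apply/rowP => i; rewrite !mxE RRe_real //.
    exact: (mxOverP (hermitian_spectral_diag_real Hherm)).
  rewrite diag_mx_col_perm mxtC_mul !mulmxA.
  by rewrite !mulmxKtV ?perm_mx_unitary // -mulmxA.
- by move=> i j ij; rewrite !mxE sP.
Qed.

Lemma psdmx_diag_ge0 n (M U : 'M[C]_n) (x : 'rV[R]_n) :
  psdmx M -> U \is unitarymx -> M = U^t* *m diag_mx (map_mx toC x) *m U ->
  forall i, 0 <= x 0 i.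
Proof.
move=> [_ M_ge0] Uu ME i.
have : 0 <= (diag_mx (map_mx toC x)) i i.
  suff -> : diag_mx (map_mx toC x) i i = ((col i (U^t*))^t* *m M *m col i (U^t*)) 0 0.
    exact: M_ge0.
  have -> : col i (U^t*) = U^t* *m delta_mx i 0 by rewrite colE.
  rewrite mxtC_mul trmxCK ME !mulmxA !(mulmxtVK _ Uu).
  by rewrite -mulmxA -colE trmx_delta map_delta_mx -rowE !mxE.
by rewrite !mxE eqxx mulr1n ler0c.
Qed.

Lemma symmetric_norm_unitary_conj m (N : 'M[C]_m -> R) (U H : 'M[C]_m) :
  symmetric_norm N -> U \is unitarymx -> N (U^t* *m H *m U) = N H.
Proof.
by move=> [_ NU] Uu; apply: NU; rewrite ?trmxC_unitary.
Qed.

(** On real diagonals [N] is convex by the norm axioms and permutation-invariant because permutation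
    matrices are unitary. *)
Lemma symmetric_norm_majorization m (N : 'M[C]_m -> R) (x y : 'rV[R]_m) :
  symmetric_norm N ->
  (forall i j : 'I_m, (i <= j)%N -> x 0 j <= x 0 i) ->
  (forall l : nat,
     \sum_(i < m | (i < l)%N) x 0 i <= \sum_(i < m | (i < l)%N) y 0 i) ->
  \sum_i x 0 i = \sum_i y 0 i ->
  N (diag_mx (map_mx toC x)) <= N (diag_mx (map_mx toC y)).
Proof.
move=> Nsym; have [[_ _ NZ ND] NU] := Nsym.
apply: (majorization_le (f := fun x => N (diag_mx (map_mx toC x)))).
- move=> t u v /andP[t_ge0 t_le1].
  have NtoC (c : R) H : 0 <= c -> N (toC c *: H) = c * N H.
    move=> c_ge0; rewrite NZ; congr (_ * _).
    by rewrite /= expr0n addr0 sqrtr_sqr ger0_norm.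
  rewrite map_mxD !map_mxZ linearD !linearZ /= (le_trans (ND _ _)) //.
  by rewrite !NtoC ?subr_ge0.
- move=> i j u; rewrite map_xcol /xcol diag_mx_col_perm.
  by rewrite NU ?trmxC_unitary ?perm_mx_unitary.
Qed.

End Norm.

(** * Rotating the block matrix *)

Section Blocks.

Variables (R : realType) (n : nat).
Local Notation C := R[i].
Implicit Types (A B X H : 'M[C]_n) (w : C).

(** For unitary [H] and unit [w], the frames of [w] and [- w] are the two column halves of a
    unitary. Taking an eigenbasis of [A + B] for [H] will diagonalize both diagonal blocks at
    once. *)
Definition half_frame w H : 'M[C]_(n + n, n) := sqrtC 2^-1 *: col_mx H (w *: H).

Lemma sqrtC_half_mul_conj : (sqrtC 2^-1)^* * sqrtC 2^-1 = 2^-1 :> C.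
Proof.
have s_ge0 : 0 <= sqrtC 2^-1 :> C by rewrite sqrtC_ge0 invr_ge0 ler0n.
by rewrite (CrealP (ger0_real s_ge0)) -expr2 sqrtCK.
Qed.

(** For [w1 = w2 = w] of modulus 1 the inner matrix is [A + B] plus [w *: X] and its adjoint, the
    part that becomes scalar. *)
Lemma half_frame_form w1 w2 A B X H :
  (half_frame w1 H)^t* *m block_mx A X (X^t*) B *m half_frame w2 H =
  2^-1 *: (H^t* *m (A + (w1^* * w2) *: B + w2 *: X + w1^* *: X^t*) *m H).
Proof.
rewrite /half_frame mxtC_scale -!scalemxAl -scalemxAr scalerA sqrtC_half_mul_conj.
congr (_ *: _); rewrite tr_col_mx map_row_mx mxtC_scale.
rewrite mul_row_block mul_row_col !mulmxDr !mulmxDl.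
rewrite -!scalemxAr -!scalemxAl.
move: (_ *m A *m H) (_ *m B *m H) (_ *m X *m H) (_ *m X^t* *m H) => a b c d.
by apply/matrixP => i j; rewrite !mxE; ring.
Qed.

(** The off-diagonal blocks of each outer product are odd in [w], so they cancel between [w] and
    [- w]. *)
Lemma half_frame_complete w H : w^* * w = 1 -> H *m H^t* = 1%:M ->
  half_frame w H *m (half_frame w H)^t* +
  half_frame (- w) H *m (half_frame (- w) H)^t* = 1%:M.
Proof.
move=> w_unit HK.
have outer v : half_frame v H *m (half_frame v H)^t* =
    2^-1 *: block_mx 1%:M (v^* *: 1%:M) (v *: 1%:M) ((v^* * v) *: 1%:M).
  rewrite /half_frame mxtC_scale -scalemxAl -scalemxAr scalerA mulrC.
  rewrite sqrtC_half_mul_conj; congr (_ *: _).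
  rewrite tr_col_mx map_row_mx mxtC_scale mul_col_row.
  by rewrite -!scalemxAr -!scalemxAl scalerA HK.
rewrite !outer rmorphN mulrNN w_unit -scalerDr add_block_mx !scaleNr !subrr scale1r.
rewrite scale_block_mx !scaler0 -mulr2n -(scaler_nat 2 1%:M).
by rewrite scalerA mulVf ?pnatr_eq0 // scale1r -scalar_mx_block.
Qed.

(** The real case takes [w = 1]. The imaginary case takes [w = -i], since [-i X + i X^*] is twice
    [Im_mx X]. *)
Lemma rotate_to_scalar X (r : C) : Im_mx X = r%:M \/ Re_mx X = r%:M ->
  exists2 w : C, w^* * w = 1 & w *: X + w^* *: X^t* = (r *+ 2)%:M.
Proof.
have two0 : 2 != 0 :> C by rewrite pnatr_eq0.
pose im : C := (0 +i* 1)%C.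
have im2 : im * im = -1 by rewrite -expr2 sqr_i.
have imJ : im^* = - im by apply/eqP; rewrite eq_complex /= oppr0 !eqxx.
case=> XE; last first.
  exists 1; rewrite rmorph1 ?mulr1 // -scalerDr scale1r -[LHS]scale1r -(mulfV two0).
  by rewrite -scalerA [_ *: (_ + _)]XE scale_scalar_mx mulr_natl.
have im0 : im != 0.
  by apply/eqP => imE; move/eqP: im2; rewrite imE mul0r eq_sym oppr_eq0 oner_eq0.
exists (- im); first by rewrite rmorphN /= imJ opprK mulrN im2 opprK.
rewrite rmorphN /= imJ opprK -[X in _ + X *: _](opprK im) (scaleNr (- im)) -scalerBr.
have -> : X - X^t* = (2 * im * r)%:M.
  rewrite -scale_scalar_mx -XE scalerA divff ?scale1r //.
  by rewrite mulf_neq0.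
by rewrite scale_scalar_mx; congr _%:M; rewrite -mulr_natl; ring: im2.
Qed.

End Blocks.

Theorem theorem2p5 (R : realType) (n : nat) (A B X : 'M[R[i]]_n) :
  psdmx (block_mx A X (X ^t*) B) ->
  (exists r : R[i], Im_mx X = r%:M \/ Re_mx X = r%:M) ->
  forall N : 'M[R[i]]_(n + n) -> R, symmetric_norm N ->
    N (block_mx A X (X ^t*) B) <= induced_norm N (A + B).
Proof.
move=> M_psd [r ImRe] N Nsym.
set M := block_mx A X (X^t*) B in M_psd *.
have [A_herm B_herm] : A^t* = A /\ B^t* = B.
  have [/is_hermitianmxP + _] := M_psd.
  rewrite expr0 scale1r tr_block_mx map_block_mx => /eq_block_mx[<- _ _ <-].
  by [].
have [w w_unit wX] : exists2 w : R[i], w^* * w = 1 &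
    w *: X + w^* *: X^t* = (r *+ 2)%:M by exact: rotate_to_scalar.
have S_herm : A + B \is hermsymmx.
  by apply/is_hermitianmxP; rewrite expr0 scale1r linearD map_mxD /= A_herm B_herm.
have [G [s [Gu SE s_dec]]] := hermsymmx_spectral S_herm.
have [P [x [Pu ME x_dec]]] := hermsymmx_spectral (proj1 M_psd).
have x_ge0 := psdmx_diag_ge0 M_psd Pu ME.
have GK : G *m G^t* = 1%:M by apply/unitarymxP.
have GSG : G *m (A + B) *m G^t* = diag_mx (map_mx (real_complex R) s).
  by rewrite SE !mulmxA GK mul1mx mulmxtVK.
(* The sign [e], 1 or -1, selects the half; [P] passes to the eigenbasis of [M]. The compression of
   [diag x] by [W e] is then the diagonal block with spectrum [p e]. *)
pose W e := P *m half_frame (e * w) (G^t*).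
pose p e : 'rV[R[i]]_n := \row_j ((s 0 j)%:C%C / 2 + e * r).
have form e : e^* * e = 1 -> e^* = e ->
    (W e)^t* *m diag_mx (map_mx (real_complex R) x) *m W e = diag_mx (p e).
  move=> e2 eR; rewrite mxtC_mul.
  rewrite -[in LHS]mulmxA -[in LHS](mulmxA _ (P^t*)) (mulmxA (P^t*)).
  rewrite (mulmxA _ P) -ME mulmxA.
  rewrite half_frame_form trmxCK rmorphM /= mulrACA e2 w_unit mulr1 scale1r eR.
  rewrite -addrA -!scalerA -scalerDr wX mulmxDr mulmxDl GSG -scalemxAr mul_mx_scalar.
  rewrite -!scalemxAl GK.
  apply/matrixP => i j; rewrite !mxE.
  by case: eqP => _; rewrite ?mulr1n ?mulr0n; field.
have complete : W 1 *m (W 1)^t* + W (-1) *m (W (-1))^t* = 1%:M.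
  rewrite /W mulN1r mul1r !mxtC_mul !mulmxA -mulmxDl -!(mulmxA P) -mulmxDr.
  rewrite half_frame_complete ?trmxCK ?unitarymx_tmul // mulmx1.
  exact/unitarymxP.
have conj1 : 1^* = 1 :> R[i] by rewrite rmorph1.
have conjN1 : (-1)^* = -1 :> R[i] by rewrite rmorphN /= conj1.
(* The common shift [c * r] cancels in the comparison, so both spectra inherit the order of [s]. *)
have p_dec : forall c (i j : 'I_n), (i <= j)%N -> p c 0 j <= p c 0 i.
  move=> c i j ij; rewrite !mxE lerD2r ler_pM2r ?invr_gt0 ?ltr0n // lecR.
  exact: s_dec.
have xC_ge0 i : 0 <= map_mx (real_complex R) x 0 i by rewrite mxE ler0c.
have [] := diag_blocks_prefix complete xC_ge0 (form 1 _ _) (form (-1) _ _)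
  (p_dec 1) (p_dec (-1)); rewrite ?conj1 ?conjN1 ?mulrNN ?mulr1 //.
have pE j : p 1 0 j + p (-1) 0 j = (s 0 j)%:C%C.
  by rewrite !mxE; field.
rewrite (eq_bigr _ (fun j _ => pE j)) => pre tot.
(* The spectrum of [A + B] padded with zeros, so that prefixes longer than [n] also reduce to sums
   over [s]. *)
pose y : 'rV[R]_(n + n) := row_mx s 0.
have sum_y (Q : pred nat) : \sum_(i < n + n | Q i) y 0 i = \sum_(i < n | Q i) s 0 i.
  rewrite big_split_ord /= [X in _ + X]big1 => [|i _]; last by rewrite row_mxEr mxE.
  by rewrite addr0; apply: eq_bigr => i _; rewrite row_mxEl.
have -> : N M = N (diag_mx (map_mx (real_complex R) x)).
  by rewrite ME symmetric_norm_unitary_conj.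
have -> : induced_norm N (A + B) = N (diag_mx (map_mx (real_complex R) y)).
  pose GG : 'M[R[i]]_(n + n) := block_mx G 0 0 G.
  have GGu : GG \is unitarymx.
    apply/unitarymxP; rewrite tr_block_mx map_block_mx !trmx0 !map_mx0 mulmx_block.
    by rewrite !(mulmx0, mul0mx) !(addr0, add0r) GK -scalar_mx_block.
  rewrite -(symmetric_norm_unitary_conj _ Nsym GGu) /induced_norm; congr (N _).
  rewrite map_row_mx diag_mx_row map_mx0 linear0.
  rewrite tr_block_mx map_block_mx !trmx0 !map_mx0 !mulmx_block.
  by rewrite !(mulmx0, mul0mx, addr0) -SE.
apply: symmetric_norm_majorization => // [l|].
  rewrite (sum_y (fun i => (i < l)%N)) -lecR !rmorph_sum /=.
  rewrite -(eq_bigr _ (fun j _ => pE j)); apply: le_trans (pre l).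
  by apply: ler_sum => i _; rewrite mxE.
apply: (@complexI R); rewrite (sum_y predT) !rmorph_sum /= -tot.
by apply: eq_bigr => i _; rewrite mxE.
Qed.
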